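(* Let $(X,\mathcal{T},E)$ and $(Y,\mathcal{S},E')$ be soft topological spaces and let $f$ be a soft function from $(X,\mathcal{T},E)$ onto $(Y,\mathcal{S},E')$. The following are equivalent: (1) $f$ is soft $sw$-open; (2) for each soft dense set $D_{E'}$ over $Y$, the soft set $f^{-1}(D_{E'})$ is soft dense over $X$.
   Context: A soft set $F_E$ over a set $X$ with parameter set $E$ is a map $F:E\to\mathcal{P}(X)$. The null soft set $\Phi_E$ has all values $\emptyset$; the absolute soft set $X_E$ has all values $X$. Inclusion $\sqsubseteq$, union $\sqcup$, intersection $\sqcap$ and complement are taken parameterwise. A soft topology $\mathcal{T}$ on $X$ is a family of soft sets over $X$ (with parameters $E$) containing $\Phi_E$ and $X_E$ and closed under finite intersections and arbitrary unions; $(X,\mathcal{T},E)$ is a soft topological space, members of $\mathcal{T}$ are soft open and their complements are soft closed. $\mathrm{Int}(F_E)$ is the largest soft open set contained in $F_E$ and $\mathrm{Cl}(F_E)$ the smallest soft closed set containing $F_E$. A soft set is soft dense if its soft closure is the absolute soft set. A soft function $f$ from $X$ (parameters $E$) to $Y$ (parameters $E'$) is given by maps $u:X\to Y$ and $p:E\to E'$; $f(F_E)(e')=\bigcup_{e\in p^{-1}(e')}u(F(e))$ for $e'\in E'$, and $f^{-1}(G_{E'})(e)=u^{-1}(G(p(e)))$ for $e\in E$. It is onto if both $u$ and $p$ are surjective. A soft set is soft $sw$-open (soft somewhat open) if it is null or its soft interior is non-null. The soft function $f$ is soft $sw$-open if $f(U_E)$ is soft $sw$-open over $Y$ for each soft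 open set $U_E$ over $X$. *)

(* Defs.v *)
From mathcomp Require Import all_boot.
From mathcomp Require Import boolp classical_sets functions.

Set Implicit Arguments.
Unset Strict Implicit.
Unset Printing Implicit Defensive.

Local Open Scope classical_set_scope.

Definition soft_set (X E : Type) : Type := E -> set X.

Section SoftSetOperations.
Context {X E : Type}.
Implicit Types (F G : soft_set X E) (A : set (soft_set X E)).

Definition soft_null : soft_set X E := fun _ => set0.
Definition soft_absolute : soft_set X E := fun _ => setT.
Definition soft_subset F G : Prop := forall e, F e `<=` G e.
Definition soft_inter F G : soft_set X E := fun e => F e `&` G e.
Definition soft_compl F : soft_set X E := fun e => ~` F e.
Definition soft_bigcup A : soft_set X E := fun e => \bigcup_(F in A) F e.
Definition soft_bigcap A : soft_set X E := fun e => \bigcap_(F in A) F e.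

End SoftSetOperations.

(* As [soft_absolute] is open, closure under binary intersections amounts to
   closure under finite ones. *)
Structure soft_topology (X E : Type) := SoftTopology {
  soft_open : set (soft_set X E);
  soft_open_null : soft_open soft_null;
  soft_open_absolute : soft_open soft_absolute;
  soft_open_inter : forall F G,
    soft_open F -> soft_open G -> soft_open (soft_inter F G);
  soft_open_bigcup : forall A : set (soft_set X E),
    A `<=` soft_open -> soft_open (soft_bigcup A) }.

Section SoftTopologyNotions.
Context {X E : Type} (T : soft_topology X E).
Implicit Types F G : soft_set X E.

Definition soft_closed F : Prop := soft_open T (soft_compl F).

Definition soft_interior F : soft_set X E :=
  soft_bigcup [set G | soft_open T G /\ soft_subset G F].

Definition soft_closure F : soft_set X E :=
  soft_bigcap [set G | soft_closed G /\ soft_subset F G].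

Definition soft_dense F : Prop := soft_closure F = soft_absolute.

Definition soft_sw_open F : Prop :=
  F = soft_null \/ soft_interior F <> soft_null.

Lemma soft_interior_largest F :
  [/\ soft_open T (soft_interior F), soft_subset (soft_interior F) F &
      forall G, soft_open T G -> soft_subset G F ->
        soft_subset G (soft_interior F)].
Proof.
split.
- by apply: soft_open_bigcup => G [].
- by move=> e x [G [_ GF] Gx]; apply: GF.
- by move=> G oG GF e x Gx; exists G.
Qed.

Lemma soft_closure_smallest F :
  [/\ soft_closed (soft_closure F), soft_subset F (soft_closure F) &
      forall G, soft_closed G -> soft_subset F G ->
        soft_subset (soft_closure F) G].
Proof.
split.
- rewrite /soft_closed.
  have -> : soft_compl (soft_closure F) =
      soft_bigcup [set soft_compl G |
                    G in [set G | soft_closed G /\ soft_subset F G]].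
    apply/funext => e; rewrite /soft_compl /soft_closure /soft_bigcap.
    by rewrite setC_bigcap /soft_bigcup bigcup_image.
  by apply: soft_open_bigcup => _ [G [cG _] <-].
- by move=> e x Fx G [_ FG]; apply: FG.
- by move=> G cG FG e x; apply.
Qed.

End SoftTopologyNotions.

Structure soft_function (X E Y E' : Type) := SoftFunction {
  soft_point_map : X -> Y;
  soft_param_map : E -> E' }.

Section SoftFunctionNotions.
Context {X E Y E' : Type} (f : soft_function X E Y E').

Definition soft_image (F : soft_set X E) : soft_set Y E' :=
  fun e' => \bigcup_(e in soft_param_map f @^-1` [set e'])
              (soft_point_map f @` F e).

Definition soft_preimage (G : soft_set Y E') : soft_set X E :=
  fun e => soft_point_map f @^-1` G (soft_param_map f e).

Definition soft_onto : Prop :=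
  set_surj setT setT (soft_point_map f) /\
  set_surj setT setT (soft_param_map f).

Definition soft_sw_open_function
    (T : soft_topology X E) (S : soft_topology Y E') : Prop :=
  forall U, soft_open T U -> soft_sw_open S (soft_image U).

End SoftFunctionNotions.

(* Main.v *)
From mathcomp Require Import all_boot.
From mathcomp Require Import boolp classical_sets.
Require Import Defs.

(** A soft set is dense exactly when it meets every non-null soft open set
    (lemma [soft_denseP]).

    If [f] is soft sw-open and [D] is dense, take a non-null open [U]: its image
    is non-null, so the interior of the image is non-null and meets [D]; a point
    of [U] lying over such a common point is in the preimage of [D].

    Conversely, if the image of an open [U] has null interior, then the
    complement of the image is dense, hence so is its preimage.  That preimage is
    disjoint from [U], so [U] is null and its image is null too. *)

Set Implicit Arguments.
Unset Strict Implicit.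
Unset Printing Implicit Defensive.

Local Open Scope classical_set_scope.

Lemma soft_not_nullP (X E : Type) (F : soft_set X E) :
  F <> soft_null <-> exists e x, F e x.
Proof.
split=> [F0|[e [x Fx]] F0]; last by move: Fx; rewrite F0.
apply: contrapT => nF; apply: F0; apply/funext => e; apply/seteqP.
by split=> // x Fx; apply: nF; exists e, x.
Qed.

Lemma soft_denseP (X E : Type) (T : soft_topology X E) (D : soft_set X E) :
  soft_dense T D <->
  forall U, soft_open T U -> U <> soft_null -> soft_inter U D <> soft_null.
Proof.
split=> [dD U oU /soft_not_nullP[e [x Ux]] UD0|meetD].
- (* The complement of [U] is closed and contains [D], hence the closure. *)
  have : soft_closure T D e x by rewrite dD.
  move=> /(_ (soft_compl U)); apply=> //; split.
    rewrite /= /soft_closed.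
    suff -> : soft_compl (soft_compl U) = U by [].
    by apply/funext => e'; apply: setCK.
  move=> e' x' Dx' Ux'.
  by have /soft_not_nullP : exists e x, soft_inter U D e x by exists e', x'.
- apply/funext => e; apply/seteqP; split=> // x _ G [cG DG].
  apply: contrapT => nGx.
  have /soft_not_nullP /(meetD _ cG) : exists e x, soft_compl G e x.
    by exists e, x.
  by move=> /soft_not_nullP[e' [x' [nGx' /DG]]].
Qed.

Lemma soft_dense_compl (X E : Type) (T : soft_topology X E) (F : soft_set X E) :
  soft_interior T F = soft_null -> soft_dense T (soft_compl F).
Proof.
move=> iF0; apply/soft_denseP => U oU /soft_not_nullP[e [x Ux]] UF0.
have [_ _ maxF] := soft_interior_largest T F.
have UF : soft_subset U F.
  move=> e' x' Ux'; apply: contrapT => nFx'.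
  by have /soft_not_nullP : exists e x, soft_inter U (soft_compl F) e x
    by exists e', x'.
by have := maxF U oU UF e x Ux; rewrite iF0.
Qed.

Lemma soft_imageP (X E Y E' : Type) (f : soft_function X E Y E')
    (F : soft_set X E) (e' : E') (y : Y) :
  soft_image f F e' y <->
  exists e x, [/\ F e x, soft_param_map f e = e' & soft_point_map f x = y].
Proof.
split=> [[e pe [x Fx uxy]]|[e [x [Fx pe uxy]]]]; first by exists e, x.
by exists e => //; exists x.
Qed.

Theorem theorem5p5 (X E Y E' : Type)
    (T : soft_topology X E) (S : soft_topology Y E')
    (f : soft_function X E Y E') (f_onto : soft_onto f) :
  soft_sw_open_function f T S <->
  (forall D : soft_set Y E', soft_dense S D -> soft_dense T (soft_preimage f D)).
Proof.
split=> [sw_f D /soft_denseP dD|dense_pre U oU].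
- apply/soft_denseP => U oU /soft_not_nullP[e [x Ux]].
  have [fU0|ifU] := sw_f U oU.
    have : soft_image f U (soft_param_map f e) (soft_point_map f x).
      by apply/soft_imageP; exists e, x.
    by rewrite fU0.
  have [oI subI _] := soft_interior_largest S (soft_image f U).
  have /soft_not_nullP[e' [y [/subI + Dy]]] := dD _ oI ifU.
  move=> /soft_imageP[e1 [x1 [Ux1 pe1 ux1]]].
  apply/soft_not_nullP; exists e1, x1; split=> //.
  by rewrite /soft_preimage /= pe1 ux1.
- have [ifU0|] := pselect (soft_interior S (soft_image f U) = soft_null);
    last by right.
  left; apply: contrapT => /soft_not_nullP[e' [y /soft_imageP[e [x [Ux _ _]]]]].
  have /soft_denseP dpre := dense_pre _ (soft_dense_compl ifU0).
  have /soft_not_nullP U0 : exists e x, U e x by exists e, x.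
  have /soft_not_nullP[e1 [x1 [Ux1]]] := dpre U oU U0.
  by apply; apply/soft_imageP; exists e1, x1.
Qed.
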